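(* Let $\Delta$ be the clique complex of a chordal graph on vertex set $X$ with $e\ge2$ maximal cliques. Although the separators $Q_1,\ldots,Q_{e-1}$ are defined from a leaf order of the facets, their multiset as subsets of $X$ is independent of that order: any two leaf orders of the facets of $\Delta$ yield the same multiset $\{Q_1,\ldots,Q_{e-1}\}$ of subsets of $X$. Consequently, the multiset of separator cardinalities $\{r_1,\ldots,r_{e-1}\}$, $r_m=|Q_m|$, is also independent of the leaf order.
   Context: The clique complex of a finite graph with vertex set $X$ consists of its cliques; its facets are the maximal cliques. A leaf order of the facets is an ordering $S_1,\ldots,S_e$ such that for each $m\ge2$ there is $p(m)<m$ satisfying $S_m\cap S_i\subseteq S_m\cap S_{p(m)}$ for all $i<m$; such an order exists when the graph is chordal. For $1\le m\le e-1$ the separators of the leaf order are $Q_m=(S_1\cup\cdots\cup S_m)\cap S_{m+1}=S_{p(m+1)}\cap S_{m+1}$ (possibly empty). *)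

(* Defs.v *)
From mathcomp Require Import all_boot.

Set Implicit Arguments.
Unset Strict Implicit.
Unset Printing Implicit Defensive.

(* MathComp.  A finite simple graph on the vertex type [T] is a symmetric     *)
(* irreflexive relation [g : rel T].                                          *)

Section CliqueComplex.

Variable T : finType.

(* Every cycle without repeated vertices and of length at least 4 has a       *)
(* chord: an edge between two of its vertices that are not consecutive on it. *)
Definition chordal (g : rel T) : Prop :=
  forall c : seq T, ucycle g c -> 4 <= size c ->
    exists x y : T,
      [/\ x \in c, y \in c, g x y, y != next c x & x != next c y].

Definition is_clique (g : rel T) (A : {set T}) : bool :=
  [forall x in A, forall y in A, (x != y) ==> g x y].

Definition clique_complex (g : rel T) : {set {set T}} :=
  [set A | is_clique g A].

Definition facets (Delta : {set {set T}}) : {set {set T}} :=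
  [set F | maxset (mem Delta) F].

(* Indices start at 0: the facet S_m is [nth set0 s m.-1].                    *)
Definition leaf_order (Delta : {set {set T}}) (s : seq {set T}) : Prop :=
  perm_eq s (enum (facets Delta)) /\
  forall m : nat, 0 < m < size s ->
    exists2 p : nat, p < m &
      forall i : nat, i < m ->
        nth set0 s m :&: nth set0 s i \subset nth set0 s m :&: nth set0 s p.

(* The sequence Q_1, ..., Q_{e-1}, e = size s; its entry of index m is        *)
(* Q_{m+1}.  Multisets are compared by [perm_eq].                             *)
Definition separators (s : seq {set T}) : seq {set T} :=
  [seq (\bigcup_(i < m.+1) nth set0 s i) :&: nth set0 s m.+1
     | m <- iota 0 (size s).-1].

End CliqueComplex.

(* Main.v *)
Require Import Defs.
From mathcomp Require Import all_boot.

(** Fix a vertex set [A] and count, along a leaf order, the separators that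
    contain it.  A separator lies in its facet [S_m] and in the earlier facet
    [S_(p m)], so if it contains [A] then [S_m] is a facet containing [A] that
    is not the first such facet.  Conversely, if [S_m] and some earlier [S_i]
    both contain [A], then so does the separator at [S_m].  Hence the
    separators containing [A] correspond to all but the first of the facets
    containing [A], and their number depends only on the set of facets
    ([count_separators_above]).

    These numbers, for all [A], determine the multiset of separators: by
    Moebius inversion over the lattice of subsets, a finite multiset of sets is
    determined by how many of its members contain each given set
    ([perm_eq_count_above]). *)

Lemma count_sum_mem (I : finType) (P : pred I) (s : seq I) :
  count P s = \sum_(x | P x) count_mem x s.
Proof.
rewrite -sum1_count (partition_big id P) //.
apply: eq_bigr => x Px; rewrite sum1_count; apply: eq_count => y /=.
by case: eqP => [->|]; rewrite ?andbF ?Px.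
Qed.

(** Moebius inversion, run as an induction from the top: the members that
    contain [A] are those equal to [A] and those that contain it properly, and
    the latter are counted by multiplicities of larger sets. *)
Lemma perm_eq_count_above (T : finType) (s t : seq {set T}) :
  (forall A : {set T},
      count (fun B : {set T} => A \subset B) s = count (fun B : {set T} => A \subset B) t) ->
  perm_eq s t.
Proof.
move=> eq_above; apply/allP => A _ /=; apply/eqP.
have above_split (B : {set T}) (u : seq {set T}) :
    count (fun C : {set T} => B \subset C) u
      = count_mem B u + count (fun C : {set T} => B \proper C) u.
  elim: u => //= C u ->; rewrite addnACA; congr (_ + _).
  by rewrite subEproper eq_sym; case: eqP => [->|//]; rewrite properxx.
elim: {A}_.+1 {-2}A (ltnSn #|~: A|) => // n IHn A leAn.
have := eq_above A; rewrite !above_split !(count_sum_mem _ (fun C : {set T} => A \proper C)).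
rewrite [in X in _ = X -> _](eq_bigr (fun C => count_mem C s)) => [/addIn //|C ltAC].
apply/esym/IHn; rewrite ltnS in leAn; apply: leq_trans leAn.
by rewrite proper_card // properC.
Qed.

Section LeafOrder.

Variables (T : finType) (s : seq {set T}).
Hypothesis leaf_parent : forall m : nat, 0 < m < size s ->
  exists2 p : nat, p < m &
    forall i : nat, i < m ->
      nth set0 s m :&: nth set0 s i \subset nth set0 s m :&: nth set0 s p.

(** The parent facet bounds every earlier intersection, so a set covered by
    the union of the earlier facets and by the new one already lies in a single
    earlier facet. *)
Lemma sub_separator (A : {set T}) (n : nat) : n.+1 < size s ->
  (A \subset (\bigcup_(i < n.+1) nth set0 s i) :&: nth set0 s n.+1)
    = has (fun F : {set T} => A \subset F) (take n.+1 s)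
        && (A \subset nth set0 s n.+1).
Proof.
move=> lt_n_s; rewrite subsetI; apply: andb_id2r => sAn.
have size_pre : size (take n.+1 s) = n.+1 by rewrite size_takel // ltnW.
apply/idP/(has_nthP set0) => [sAU|[i]]; rewrite size_pre.
  have [p lt_p_n sep_p] := leaf_parent n.+1 lt_n_s.
  exists p; rewrite // nth_take //.
  apply/subsetP => x xA.
  have /bigcupP[i _ xi] := subsetP sAU _ xA.
  have /subsetP/(_ x) := sep_p i (ltn_ord i).
  by rewrite !inE xi (subsetP sAn) // => /(_ isT).
move=> lt_i_n; rewrite nth_take // => sAi; apply: subset_trans sAi _.
exact: (bigcup_sup (Ordinal lt_i_n)).
Qed.

(** Among the facets containing [A], every one but the first contributes
    exactly one separator containing [A]; the predecessor also covers the case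
    where no facet contains [A]. *)
Lemma count_separators_above (A : {set T}) :
  count (fun Q : {set T} => A \subset Q) (separators s)
    = (count (fun F : {set T} => A \subset F) s).-1.
Proof.
case: (posnP (size s)) => [/size0nil-> //|s_gt0].
suffices pre n : n < size s ->
    count (fun Q : {set T} => A \subset Q)
      [seq (\bigcup_(i < m.+1) nth set0 s i) :&: nth set0 s m.+1
         | m <- iota 0 n]
    = (count (fun F : {set T} => A \subset F) (take n.+1 s)).-1.
  by rewrite [LHS]pre ?prednK // take_size.
elim: n => [_ | n IHn lt_n_s].
  by rewrite (take_nth set0) // take0 /=; case: (A \subset _).
rewrite -addn1 iotaD map_cat count_cat add0n (IHn (ltnW lt_n_s)) /= addn0.
rewrite sub_separator // addn1 (take_nth set0 lt_n_s) -cats1 count_cat /= addn0.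
rewrite has_count.
by case: (count _ _) => [|k]; case: (A \subset nth set0 s n.+1).
Qed.

End LeafOrder.

Theorem corollary8 (T : finType) (g : rel T)
    (g_sym : symmetric g) (g_irr : irreflexive g) (g_chordal : chordal g)
    (e_ge2 : 2 <= #|facets (clique_complex g)|)
    (s t : seq {set T})
    (s_leaf : leaf_order (clique_complex g) s)
    (t_leaf : leaf_order (clique_complex g) t) :
  perm_eq (separators s) (separators t) /\
  perm_eq [seq #|Q : {set T}| | Q <- separators s]
          [seq #|Q : {set T}| | Q <- separators t].
Proof.
have [s_facets s_parent] := s_leaf; have [t_facets t_parent] := t_leaf.
have eq_seps : perm_eq (separators s) (separators t).
  apply: perm_eq_count_above => A; rewrite !count_separators_above //.
  have /permP-> // : perm_eq s t.
  by rewrite (perm_trans s_facets) // perm_sym.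
by split; last exact: perm_map.
Qed.
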